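(* Let $G=(V,E)$ be a connected finite weighted graph with measure $\mu$, let $n,N$ be positive integers, let $m_e,m_g$ be nonzero real constants, and let $p_1,\dots,p_n\in V$. The system $$\Delta u_{1}=-N m_{e}^{2}+m_{e}^{2}\left(e^{\frac{u_{1}}{N}+\frac{N-1}{N} u_{2}}+(N-1) e^{\frac{u_{1}}{N}-\frac{u_{2}}{N}}\right)+4 \pi \sum_{j=1}^{n} \delta_{p_{j}}(x),$$ $$\Delta u_{2}=m_{g}^{2}\left(e^{\frac{u_{1}}{N}+\frac{N-1}{N} u_{2}}-e^{\frac{u_{1}}{N}-\frac{u_{2}}{N}}\right)+4 \pi \sum_{j=1}^{n} \delta_{p_{j}}(x)\qquad (x\in V)$$ admits a unique solution $(u_1,u_2)$, $u_1,u_2:V\to\mathbb{R}$, if and only if $$|V|>\frac{4 \pi n}{N m_{e}^{2}}+\frac{4 \pi n(N-1)}{N m_{g}^{2}}.$$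
   Context: $G=(V,E)$ is a connected finite graph with vertex set $V$ and edge set $E$. Each edge $xy\in E$ carries a weight $\omega_{xy}>0$ with $\omega_{xy}=\omega_{yx}$; $y\sim x$ means $xy\in E$. $\mu:V\to(0,+\infty)$ is a finite measure, and $|V|=\mathrm{Vol}(V)=\sum_{x\in V}\mu(x)$ (the volume, not the cardinality). For $u:V\to\mathbb{R}$ the Laplacian is $\Delta u(x)=\frac{1}{\mu(x)}\sum_{y\sim x}\omega_{yx}(u(y)-u(x))$, and $\int_V u\,d\mu=\sum_{x\in V}\mu(x)u(x)$. $\delta_p$ is the Dirac mass at the vertex $p$: $\delta_p(x)=1/\mu(p)$ if $x=p$ and $0$ otherwise, so $\int_V\delta_p\,d\mu=1$. The vertices $p_1,\dots,p_n$ are not assumed distinct. *)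

(* Defs.v *)
From HB Require Import structures.
From mathcomp Require Import all_boot all_order all_algebra.
From mathcomp Require Import all_classical reals sequences exp trigo.

Set Implicit Arguments.
Unset Strict Implicit.
Unset Printing Implicit Defensive.

Import Order.TTheory GRing.Theory Num.Theory.
Local Open Scope ring_scope.

(* Loops are not excluded: they do not contribute to the Laplacian. The values
   of [weight] outside the edge set are unconstrained and never used. *)
Record weighted_graph (R : realType) (V : finType) := WeightedGraph {
  edge : rel V;
  weight : V -> V -> R;
  edge_sym : symmetric edge;
  weight_sym : forall x y, edge x y -> weight x y = weight y x;
  weight_gt0 : forall x y, edge x y -> 0 < weight x y
}.

Definition connected_graph (R : realType) (V : finType)
    (G : weighted_graph R V) : Prop :=
  forall x y : V, connect (edge G) x y.

Definition volume (R : realType) (V : finType) (mu : V -> R) : R :=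
  \sum_(x : V) mu x.

Definition laplacian (R : realType) (V : finType) (G : weighted_graph R V)
    (mu : V -> R) (u : V -> R) (x : V) : R :=
  (mu x)^-1 * \sum_(y : V | edge G x y) weight G y x * (u y - u x).

Definition dirac_mass (R : realType) (V : finType) (mu : V -> R) (p x : V) : R :=
  if x == p then (mu p)^-1 else 0.

(* Main.v *)
Require Import Defs.
From HB Require Import structures.
From mathcomp Require Import all_boot all_order all_algebra ring lra.
From mathcomp Require Import all_classical reals topology normedtype derive.
From mathcomp Require Import realfun sequences exp trigo.

(** The system is the Euler-Lagrange equation of the functional
    [1/(2 m_e^2) int |grad u1|^2 + (N-1)/(2 m_g^2) int |grad u2|^2
     + int (N e^a + N (N-1) e^b) - L(u1, u2)],
    where [a = u1/N + (N-1) u2/N], [b = (u1 - u2)/N] and [L] is linear.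
    Integrating the two equations expresses [N int e^a > 0] as a positive
    multiple of the difference of the two sides of the volume condition, so
    that condition is necessary. Conversely, on the cone of constant pairs with
    [a, b <= 0] (the directions along which the quadratic and exponential parts
    stay bounded) it makes [L] negative, so the functional is coercive
    and has a minimizer. Uniqueness follows by pairing the difference of two
    solutions with itself and using the monotonicity of [exp]. For [N = 1] the
    functional does not control [u2]; there the system decouples into two scalar
    equations of the same kind, first for [u1] and then for [- u2]. *)

Set Implicit Arguments.
Unset Strict Implicit.
Unset Printing Implicit Defensive.

Import Order.TTheory GRing.Theory Num.Theory.
Import numFieldNormedType.Exports.
Local Open Scope ring_scope.
Local Open Scope classical_set_scope.

(** * Compactness and coercivity in finite dimension *)

Lemma sum_continuous (R : realType) (T : topologicalType) (K : finType)
    (f : K -> T -> R) :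
  (forall k, continuous (f k)) -> continuous (fun z => \sum_k f k z).
Proof.
move=> fc; elim: (index_enum K) => [|k s IH].
  have -> : (fun z => \sum_(k <- [::]) f k z) = cst 0.
    by apply/funext => z; rewrite big_nil.
  by move=> z; exact: cvg_cst.
have -> : (fun z => \sum_(i <- k :: s) f i z) =
          f k \+ (fun z => \sum_(i <- s) f i z).
  by apply/funext => z; rewrite big_cons.
by move=> z; apply: cvgD; [exact: fc|exact: IH].
Qed.

Lemma ptws_proj_continuous (R : realType) (I : finType) (i : I) :
  continuous (fun z : {ptws I -> R} => z i).
Proof. exact: (@proj_continuous I (fun=> R)). Qed.

Lemma l1norm_continuous (R : realType) (I : finType) :
  continuous (fun z : {ptws I -> R} => \sum_i `|z i|).
Proof.
apply: (@sum_continuous _ _ _ (fun i (z : {ptws I -> R}) => `|z i|)) => i z.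
exact: (cvg_norm (@ptws_proj_continuous R I i z)).
Qed.

Lemma box_compact (R : realType) (I : finType) (M : R) :
  compact [set z : {ptws I -> R} | forall i, `[- M, M] (z i)].
Proof. by apply: (@tychonoff I (fun=> R) (fun=> `[- M, M])) => i; exact: segment_compact. Qed.

Lemma coercive_min (R : realType) (I : finType) (f : {ptws I -> R} -> R)
    (eps C : R) :
  continuous f -> 0 < eps -> (forall z, eps * \sum_i `|z i| - C <= f z) ->
  exists z, forall v, f z <= f v.
Proof.
(* Once some [|v i|] exceeds [M], the lower bound on [f v] is at least [f] at the origin. The
   maximum with 0 keeps the origin in the box, so a minimizer over the compact box is global. *)
move=> fc eps0 fge; pose M : R := Num.max 0 ((C + f (fun=> 0)) / eps).
have [|z zB zmin] := @compact_EVT_min _ R f _ _ (@box_compact R I M)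
    (continuous_subspaceT fc).
  by exists (fun=> 0) => i /=; rewrite in_itv /= oppr_le0 le_max lexx.
exists z => v; have [vB|/forallNP] := pselect (exists i, M < `|v i|); last first.
  move=> vB; apply: zmin; rewrite inE => i /=; rewrite in_itv/= -ler_norml.
  by rewrite leNgt; apply/negP; exact: vB.
have /le_trans : f z <= f (fun=> 0).
  by apply: zmin; rewrite inE => i /=; rewrite in_itv /= oppr_le0 le_max lexx.
apply; apply: le_trans (fge v); case: vB => i; rewrite gt_max => /andP[_].
rewrite ltr_pdivrMr // (bigD1 i) //= => H.
have : 0 <= eps * \sum_(j | j != i) `|v j|.
  by apply: mulr_ge0; [exact: ltW|exact: sumr_ge0].
rewrite mulrDr; lra.
Qed.

Lemma sphere_compact (R : realType) (I : finType) :
  compact [set z : {ptws I -> R} | \sum_i `|z i| = 1].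
Proof.
apply: (subclosed_compact _ (@box_compact R I 1)) => [|z /= z1 i].
  have := @l1norm_continuous R I => /continuous_closedP.
  by move=> /(_ _ (@closed_eq R 1)).
rewrite in_itv /= -ler_norml -z1 (bigD1 i) //= lerDl.
exact: sumr_ge0.
Qed.

(* On the part of the sphere where [L] is nonnegative, compactness bounds [P]
   away from zero, so a large multiple of [P] dominates [L] there; elsewhere
   [- L] is already positive. *)
Lemma homogeneous_coercive (R : realType) (I : finType)
    (P L : {ptws I -> R} -> R) :
  continuous P -> continuous L ->
  (forall (t : R) z, 0 <= t -> P (fun i => t * z i) = t * P z) ->
  (forall (t : R) z, 0 <= t -> L (fun i => t * z i) = t * L z) ->
  (forall z, 0 <= P z) ->
  (forall z, P z = 0 -> 0 <= L z -> forall i, z i = 0) ->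
  exists A eps : R, [/\ 0 <= A, 0 < eps &
    forall z, eps * \sum_i `|z i| <= A * P z - L z].
Proof.
move=> Pc Lc Ph Lh P0 PL.
pose S := [set z : {ptws I -> R} | \sum_i `|z i| = 1].
have Sc : compact S by exact: sphere_compact.
have [A A0 AS] : exists2 A, 0 <= A & forall z, S z -> 0 < A * P z - L z.
  pose K := S `&` L @^-1` [set x | 0 <= x].
  (* If [K] is empty, [L] is negative on the whole sphere and [A = 0] suffices. *)
  have [K0|/set0P K0] := eqVneq K set0.
    exists 0 => // z Sz; rewrite mul0r sub0r oppr_gt0 ltNge; apply/negP => Lz.
    by have : K z by []; rewrite K0.
  have Kc : compact K.
    apply: (subclosed_compact _ Sc); last by move=> z [].
    apply: closedI; last first.
      by move/continuous_closedP: Lc; apply; exact: closed_ge.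
    by apply: compact_closed Sc; apply: hausdorff_product => ?; exact: Rhausdorff.
  have [y yK ymin] := compact_EVT_min K0 Kc (continuous_subspaceT Pc).
  have [x xK xmax] := compact_EVT_max K0 Kc (continuous_subspaceT Lc).
  move: yK xK; rewrite !inE => -[Sy Ly] [Sx Lx].
  have Py : 0 < P y.
    rewrite lt_neqAle P0 andbT; apply/eqP => /esym Py0.
    move: Sy; rewrite /S /= big1 => [/esym/eqP|i _]; first by rewrite oner_eq0.
    by rewrite (PL _ Py0 Ly) normr0.
  (* With [P y] the minimum of [P] and [L x] the maximum of [L] on [K], this constant gives
     [A * P z >= 1 + L x > L z] on [K]. *)
  have A0 : 0 <= (1 + L x) / P y by rewrite divr_ge0 ?addr_ge0// ltW.
  exists ((1 + L x) / P y) => // z Sz.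
  have [Lz|Lz] := leP 0 (L z); last first.
    by rewrite subr_gt0 (lt_le_trans Lz)// mulr_ge0.
  have Kz : z \in K by rewrite inE.
  have H : 1 + L x <= (1 + L x) / P y * P z.
    rewrite mulrAC ler_pdivlMr// ler_wpM2l ?addr_ge0// ?ymin//.
  have := xmax _ Kz; lra.
have Fc : continuous (fun z => A * P z - L z : R).
  by move=> z; exact: (cvgB (cvgMl_tmp (a := A) (Pc z)) (Lc z)).
have [eps eps0 epsS] : exists2 eps : R, 0 < eps &
    forall z, S z -> eps <= A * P z - L z.
  have [S0|/set0P S0] := eqVneq S set0.
    by exists 1 => // z Sz; have : set0 z by rewrite -S0.
  have [y yS ymin] := compact_EVT_min S0 Sc (continuous_subspaceT Fc).
  exists (A * P y - L y); first by apply: AS; rewrite inE in yS.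
  by move=> z Sz; apply: ymin; rewrite inE.
(* The bound on the sphere extends to every [z] by homogeneity, scaling by the l1 norm [r]; the
   origin is treated apart. *)
exists A, eps; split => // z; pose r := \sum_i `|z i|.
have r0 : 0 <= r by apply: sumr_ge0.
have [r_eq0|r_neq0] := eqVneq r 0.
  have z0 i : z i = 0.
    apply/eqP; rewrite -normr_eq0 eq_le normr_ge0 andbT -r_eq0 /r.
    by rewrite (bigD1 i) //= lerDl sumr_ge0.
  have -> : z = (fun i => 0 * z i) by apply/funext => i; rewrite z0 mul0r.
  rewrite Ph// Lh// !mul0r mulr0 subr0 big1 ?mulr0// => i _.
  by rewrite mul0r normr0.
have {r_neq0} r_gt0 : 0 < r by rewrite lt_neqAle eq_sym r_neq0.
have zE : z = (fun i => r * (r^-1 * z i)).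
  by apply/funext => i; rewrite mulrA divff ?mul1r ?gt_eqF.
have Sz : S (fun i => r^-1 * z i).
  rewrite /S /=; under eq_bigr do rewrite normrM ger0_norm ?invr_ge0//.
  by rewrite -mulr_sumr mulVf ?gt_eqF.
rewrite [in leRHS]zE Ph// Lh// -/r mulrCA -mulrBr mulrC ler_pM2l//.
exact: epsS.
Qed.

(** * Linear forms, growth bounds and derivatives along lines *)

Definition linear_form (R : realType) (I : finType) (l : (I -> R) -> R) :=
  forall t u v, l (fun i => t * u i + v i) = t * l u + l v.

Lemma linear_form0 (R : realType) (I : finType) (l : (I -> R) -> R) :
  linear_form l -> l (fun=> 0) = 0.
Proof.
move=> ll; have := ll 1 (fun=> 0) (fun=> 0).
rewrite (_ : (fun i => _) = fun=> 0); first lra.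
by apply/funext => i; rewrite mulr0 addr0.
Qed.

Lemma linear_formZ (R : realType) (I : finType) (l : (I -> R) -> R) t z :
  linear_form l -> l (fun i => t * z i) = t * l z.
Proof.
move=> ll; rewrite -[RHS]addr0 -(linear_form0 ll) -ll.
by congr l; apply/funext => i; rewrite addr0.
Qed.

(** This is [(A - |x|)^2 >= 0] expanded. Since [A] is arbitrary, a quadratic term dominates any
    multiple of [|x|] up to a constant. *)
Lemma sqr_growth (R : realType) (A x : R) :
  A * `|x| - A ^+ 2 / 2 <= x ^+ 2 / 2.
Proof. by rewrite -(real_normK (num_real x)); have := sqr_ge0 (A - `|x|); nra. Qed.

(** For [x >= 0], [exp x = exp (x/2)^2 >= (x/2)^2], and [(x/2 - A)^2 >= 0] gives the bound. This is
    the analogue of the quadratic bound for the positive part of [x]. *)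
Lemma expR_growth (R : realType) (A x : R) :
  A * Num.max x 0 - A ^+ 2 <= expR x.
Proof.
have [x0|/ltW x0] := leP x 0.
  by rewrite mulr0 sub0r; have := expR_gt0 x; have := sqr_ge0 A; lra.
have := expR_ge1Dx (x / 2); have -> : expR x = expR (x / 2) ^+ 2.
  by rewrite expr2 -expRD -splitr.
by have := sqr_ge0 (x / 2 - A); nra.
Qed.

Lemma is_derive_sum_fin (R : realType) (K : finType) (f : K -> R -> R)
    (df : K -> R) (t : R) :
  (forall k, is_derive t 1 (f k) (df k)) ->
  is_derive t 1 (fun s => \sum_k f k s) (\sum_k df k).
Proof.
move=> fd; rewrite (_ : (fun s => _) = \sum_k f k).
  elim/big_ind2: _ => // [|f1 d1 f2 d2 ? ?]; first exact: is_derive_cst.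
  exact: is_deriveD.
by apply/funext => s; rewrite fct_sumE.
Qed.

Lemma weighted_sum_continuous (R : realType) (T : topologicalType)
    (K : finType) (w : K -> R) (g : R -> R) (l : K -> T -> R) :
  continuous g -> (forall k, continuous (l k)) ->
  continuous (fun z => \sum_k w k * g (l k z)).
Proof.
move=> gc lc; apply: (sum_continuous (f := fun k z => w k * g (l k z))) => k z.
exact: (cvgMl_tmp (a := w k) (continuous_comp (lc k z) (gc (l k z)))).
Qed.

Lemma posp_continuous (R : realType) : continuous (fun x : R => Num.max x 0).
Proof.
have -> : (fun x : R => Num.max x 0) = (fun x => (x + `|x|) * 2^-1).
  apply/funext => x; have [x0|x0] := ler0P x.
    by rewrite subrr mul0r.
  by rewrite -[x + x]/(x *+ 2); lra.
by move=> x; exact: (cvgMr_tmp (b := 2^-1) (cvgD (@cvg_id _ _) (@norm_continuous _ R x))).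
Qed.

Lemma is_derive_affine (R : realType) (a b t : R) :
  is_derive t 1 (fun s => s * a + b) a.
Proof.
have H := is_deriveD (is_deriveM (is_derive_id t 1) (is_derive_cst a t 1))
  (is_derive_cst b t 1).
by apply: (is_derive_eq H); rewrite scaler0 add0r addr0 [LHS]mulr1.
Qed.

Lemma is_derive_half_sqr (R : realType) (x : R) :
  is_derive x (1 : R) (fun y => y ^+ 2 / 2) x.
Proof.
have H := is_deriveZ 2^-1 (is_deriveX 2 (is_derive_id x (1 : R))).
rewrite (_ : (fun y => _) = 2^-1 \*: (@id R ^+ 2)); last first.
  by apply/funext => y; rewrite /= mulrC.
apply: (is_derive_eq H).
rewrite -[LHS]/(2^-1 * (2%:R * x ^+ 1 * 1)); lra.
Qed.

Lemma is_derive_weighted_sum (R : realType) (K : finType) (w : K -> R)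
    (g dg : R -> R) (a b : K -> R) (t : R) :
  (forall x : R, is_derive x (1 : R) g (dg x)) ->
  is_derive t 1 (fun s => \sum_k w k * g (s * a k + b k))
    (\sum_k w k * (dg (t * a k + b k) * a k)).
Proof.
move=> gd; apply: (is_derive_sum_fin (f := fun k s => w k * g (s * a k + b k))).
move=> k; apply: (is_deriveZ (w k)).
exact: (is_derive1_comp (gd _) (is_derive_affine _ _ _)).
Qed.

(** * Critical points of a quadratic plus exponential functional *)

Section critical_point.
Variables (R : realType) (I K1 K2 : finType).
Variables (w : K1 -> R) (l : K1 -> {ptws I -> R} -> R).
Variables (c : K2 -> R) (m : K2 -> {ptws I -> R} -> R).
Variable L : {ptws I -> R} -> R.
Hypotheses (w_ge0 : forall k, 0 <= w k) (c_ge0 : forall k, 0 <= c k).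
Hypotheses (l_lin : forall k, linear_form (l k))
  (m_lin : forall k, linear_form (m k)) (L_lin : linear_form L).
Hypotheses (l_cont : forall k, continuous (l k))
  (m_cont : forall k, continuous (m k)) (L_cont : continuous L).
(* The first two conditions single out the directions along which the quadratic
   and exponential parts of the functional do not grow. *)
Hypothesis recession : forall z,
  (forall k, w k * `|l k z| = 0) -> (forall k, c k * Num.max (m k z) 0 = 0) ->
  0 <= L z -> forall i, z i = 0.

Let J (z : {ptws I -> R}) : R :=
  \sum_k w k * (l k z ^+ 2 / 2) + \sum_k c k * expR (m k z) - L z.

(** A positively homogeneous substitute for the growing part of [J]: for every [A >= 0], [J] is at
    least [A * P - L] up to a constant. *)
Let P (z : {ptws I -> R}) : R :=
  \sum_k w k * `|l k z| + \sum_k c k * Num.max (m k z) 0.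

Let J_cont : continuous J.
Proof.
have sq_cont : continuous (fun x : R => x ^+ 2 / 2).
  by move=> x; exact: (cvgMr_tmp (b := 2^-1) (@exprn_continuous R 2 x)).
have H1 := weighted_sum_continuous (w := w) sq_cont l_cont.
have H2 := weighted_sum_continuous (w := c) (@continuous_expR R) m_cont.
by move=> z; exact: (cvgB (cvgD (H1 z) (H2 z)) (@L_cont z)).
Qed.

Let P_cont : continuous P.
Proof.
have H1 := weighted_sum_continuous (w := w) (@norm_continuous _ R) l_cont.
have H2 := weighted_sum_continuous (w := c) (@posp_continuous R) m_cont.
by move=> z; exact: (cvgD (H1 z) (H2 z)).
Qed.

(** The weak Euler-Lagrange equation of [J]. The condition [recession] makes [A * P - L] coercive
    for a suitable [A], hence [J] too; at a minimizer of [J] the derivative in each direction [v]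
    vanishes. *)
Lemma critical_point : exists z, forall v,
  \sum_k w k * l k z * l k v + \sum_k c k * expR (m k z) * m k v = L v.
Proof.
have [A [eps [A0 eps0 coer]]] : exists A eps : R, [/\ 0 <= A, 0 < eps &
    forall z, eps * \sum_i `|z i| <= A * P z - L z].
  apply: homogeneous_coercive => //.
  - move=> t z t0; rewrite /P mulrDr !mulr_sumr; congr (_ + _).
      by apply: eq_bigr => k _; rewrite linear_formZ// normrM ger0_norm// mulrCA.
    apply: eq_bigr => k _; rewrite linear_formZ// mulrCA; congr (_ * _).
    by rewrite maxr_pMr// mulr0.
  - by move=> t z _; rewrite linear_formZ.
  - move=> z; rewrite addr_ge0// sumr_ge0// => k _; rewrite mulr_ge0//.
    by rewrite le_max lexx orbT.
  - move=> z /eqP; rewrite paddr_eq0 => [/andP[/eqP p1 /eqP p2]| |].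
    + move=> Lz; apply: recession => // k.
        apply/eqP; move: p1 => /eqP; rewrite psumr_eq0 => [|j _].
          by move=> /allP/(_ k (mem_index_enum k)).
        by rewrite mulr_ge0.
      apply/eqP; move: p2 => /eqP; rewrite psumr_eq0 => [|j _].
        by move=> /allP/(_ k (mem_index_enum k)).
      by rewrite mulr_ge0// le_max lexx orbT.
    + by rewrite sumr_ge0// => k _; rewrite mulr_ge0.
    + by rewrite sumr_ge0// => k _; rewrite mulr_ge0// le_max lexx orbT.
(* The constants lost in [sqr_growth] and [expR_growth], summed with their weights. *)
pose C := \sum_k w k * (A ^+ 2 / 2) + \sum_k c k * A ^+ 2.
have [z zmin] : exists z, forall v, J z <= J v.
  apply: (coercive_min (C := C) J_cont eps0) => z.
  apply: (@le_trans _ _ (A * P z - L z - C)); first by rewrite lerB.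
  have H1 : A * (\sum_k w k * `|l k z|) - \sum_k w k * (A ^+ 2 / 2) <=
      \sum_k w k * (l k z ^+ 2 / 2).
    rewrite mulr_sumr -sumrB; apply: ler_sum => k _.
    by rewrite mulrCA -mulrBr ler_wpM2l// sqr_growth.
  have H2 : A * (\sum_k c k * Num.max (m k z) 0) - \sum_k c k * A ^+ 2 <=
      \sum_k c k * expR (m k z).
    rewrite mulr_sumr -sumrB; apply: ler_sum => k _.
    by rewrite mulrCA -mulrBr ler_wpM2l// expR_growth.
  rewrite /J /P /C; lra.
exists z => v.
(* The restriction of [J] to the line through [z] with direction [v], minimal at [t = 0]. *)
pose f t := J (fun i => t * v i + z i).
have fE : f = (fun t => \sum_k w k * ((fun x => x ^+ 2 / 2) (t * l k v + l k z)) +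
   \sum_k c k * expR (t * m k v + m k z)) \- (fun t => t * L v + L z).
  apply/funext => t; rewrite /f /J /= L_lin; congr (_ + _ - _).
    by apply: eq_bigr => k _; rewrite l_lin.
  by apply: eq_bigr => k _; rewrite m_lin.
have df (t : R) : is_derive t (1 : R) f (\sum_k w k * ((t * l k v + l k z) * l k v) +
   \sum_k c k * (expR (t * m k v + m k z) * m k v) - L v).
  rewrite fE; apply: is_deriveB; last exact: is_derive_affine.
  apply: is_deriveD.
    exact: (@is_derive_weighted_sum R K1 w _ id (l^~ v) (l^~ z) t
      (@is_derive_half_sqr R)).
  exact: (@is_derive_weighted_sum R K2 c expR expR (m^~ v) (m^~ z) t
    (@is_derive_expR R)).
have f0 : is_derive (0 : R) (1 : R) f 0.
  apply: (@derive1_at_min _ f (-1) 1) => // [||t _].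
  - lra.
  - by rewrite in_itv /= ; apply/andP; split; lra.
  - rewrite /f (_ : (fun i => 0 * v i + z i) = z) //.
    by apply/funext => i; rewrite mul0r add0r.
have /esym/eqP := @derive_val _ _ _ _ _ _ _ f0.
rewrite (@derive_val _ _ _ _ _ _ _ (df 0)) eq_sym subr_eq0 => /eqP <-.
congr (_ + _).
  by apply: eq_bigr => k _; rewrite mul0r add0r mulrA.
by apply: eq_bigr => k _; rewrite mul0r add0r mulrA.
Qed.

End critical_point.

(** * The graph Laplacian and the Green identity *)

(** Extending the weights by zero turns sums over neighbours into sums over all pairs, where the two
    vertices can be exchanged freely. *)
Definition conductance (R : realType) (V : finType) (G : weighted_graph R V)
    (x y : V) : R := if edge G x y then weight G x y else 0.

Section graph.
Variables (R : realType) (V : finType) (G : weighted_graph R V).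
Variables (mu : V -> R).
Hypothesis mu_gt0 : forall x, 0 < mu x.

Lemma conductance_ge0 x y : 0 <= conductance G x y.
Proof. by rewrite /conductance; case: ifP => // /weight_gt0/ltW. Qed.

Lemma conductanceC x y : conductance G x y = conductance G y x.
Proof.
rewrite /conductance [edge G y x]edge_sym; case: ifP => // xy.
exact: weight_sym.
Qed.

Lemma mu_laplacian u x :
  mu x * laplacian G mu u x = \sum_y conductance G x y * (u y - u x).
Proof.
rewrite /laplacian mulrA divff ?gt_eqF// mul1r big_mkcond /=.
apply: eq_bigr => y _; rewrite /conductance; case: ifP => xy; last by rewrite mul0r.
by rewrite (weight_sym xy).
Qed.

(** Averaging the double sum with its copy in which [x] and [y] are swapped produces the product of
    differences. The factor 1/2 compensates for counting each edge in both orientations. *)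
Lemma green_identity u v :
  \sum_x mu x * laplacian G mu u x * v x =
  - \sum_x \sum_y conductance G x y / 2 * (u x - u y) * (v x - v y).
Proof.
pose F x y := conductance G x y * (u y - u x) * v x.
have E : \sum_x mu x * laplacian G mu u x * v x = \sum_x \sum_y F x y.
  by apply: eq_bigr => x _; rewrite mu_laplacian mulr_suml.
have E' : \sum_x \sum_y F x y = \sum_x \sum_y F y x by rewrite exchange_big.
have -> : \sum_x \sum_y conductance G x y / 2 * (u x - u y) * (v x - v y) =
    - (2^-1 * (\sum_x \sum_y F x y + \sum_x \sum_y F y x)).
  rewrite -big_split mulr_sumr -sumrN /=; apply: eq_bigr => x _.
  rewrite -big_split mulr_sumr -sumrN /=; apply: eq_bigr => y _.
  by rewrite /F (conductanceC y x); field.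
by rewrite -E' E; field.
Qed.

Lemma integral_laplacian u : \sum_x mu x * laplacian G mu u x = 0.
Proof.
under eq_bigr do rewrite -[_ * _]mulr1.
rewrite (green_identity u (fun=> 1)) big1 ?oppr0// => x _.
by rewrite big1// => y _; rewrite subrr mulr0.
Qed.

(** A function that does not vary across edges is constant along every path. *)
Lemma connected_constant (u : V -> R) : connected_graph G ->
  (forall x y, conductance G x y * `|u x - u y| = 0) -> forall x y, u x = u y.
Proof.
move=> Gc u0 x y; have /connectP[p pp ->] := Gc x y.
elim: p x pp => //= z p IH x /andP[xz /IH <-].
have /eqP := u0 x z; rewrite /conductance xz mulf_eq0 gt_eqF ?weight_gt0//=.
by rewrite normr_eq0 subr_eq0 => /eqP.
Qed.

(** * Variational systems with exponential nonlinearities *)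

Section system.
Variables (C D : finType) (alpha : C -> R) (M : D -> C -> R).
Variables (h : D -> V -> R) (k : C -> V -> R).
Hypotheses (alpha_gt0 : forall c, 0 < alpha c) (h_gt0 : forall d x, 0 < h d x).

(** [M] forms the exponents and its transpose distributes the exponentials among the equations. This
    makes the system the gradient equation of the sum of the [alpha]-weighted Dirichlet energies and
    [int h exp (M u)], minus [int k u]. *)
Definition exp_system (u : C -> V -> R) := forall c x,
  alpha c * laplacian G mu (u c) x =
  \sum_d M d c * (h d x * expR (\sum_e M d e * u e x)) - k c x.

(** Pair the difference of the equations with [w = u - v]: the Laplacian side is nonpositive by the
    Green identity, the exponential side nonnegative by monotonicity. Both vanish, so [M w = 0]
    pointwise and injectivity of [M] gives [w = 0]. *)
Lemma exp_system_unique u v :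
  (forall s : C -> R, (forall d, \sum_c M d c * s c = 0) -> forall c, s c = 0) ->
  exp_system u -> exp_system v -> u = v.
Proof.
move=> Minj su sv.
pose w c x := u c x - v c x.
pose p d x := \sum_e M d e * u e x; pose q d x := \sum_e M d e * v e x.
have pq d x : p d x - q d x = \sum_c M d c * w c x.
  by rewrite /p /q -sumrB; apply: eq_bigr => c _; rewrite mulrBr.
have lapB c x : laplacian G mu (w c) x =
    laplacian G mu (u c) x - laplacian G mu (v c) x.
  rewrite /laplacian -mulrBr -sumrB; congr (_ * _).
  by apply: eq_bigr => y _; rewrite -mulrBr /w; congr (_ * _); ring.
pose T d x := mu x * (h d x * ((expR (p d x) - expR (q d x)) * (p d x - q d x))).
have T_ge0 d x : 0 <= T d x.
  apply: mulr_ge0; first exact: ltW.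
  apply: mulr_ge0; first exact: ltW.
  have [H|/ltW H] := leP (p d x) (q d x).
    by apply: mulr_le0; rewrite subr_le0 // ler_expR.
  by apply: mulr_ge0; rewrite subr_ge0 // ler_expR.
have ET : \sum_c alpha c * (\sum_x mu x * laplacian G mu (w c) x * w c x) =
    \sum_d \sum_x T d x.
  under eq_bigr do rewrite mulr_sumr.
  rewrite exchange_big /= [RHS]exchange_big /=; apply: eq_bigr => x _.
  transitivity (\sum_c \sum_d mu x *
      (h d x * ((expR (p d x) - expR (q d x)) * (M d c * w c x)))).
    apply: eq_bigr => c _; rewrite lapB.
    have -> : alpha c * (mu x *
        (laplacian G mu (u c) x - laplacian G mu (v c) x) * w c x) =
        mu x * w c x * (alpha c * laplacian G mu (u c) x -
                        alpha c * laplacian G mu (v c) x) by ring.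
    rewrite su sv opprB addrA addrNK -sumrB mulr_sumr.
    by apply: eq_bigr => d _; rewrite -/(p d x) -/(q d x); ring.
  rewrite exchange_big /=; apply: eq_bigr => d _.
  by rewrite /T pq -!mulr_sumr.
have T0 : \sum_d \sum_x T d x = 0.
  apply/eqP; rewrite eq_le; apply/andP; split; last first.
    by apply: sumr_ge0 => d _; exact: sumr_ge0.
  rewrite -ET; apply: sumr_le0 => c _; rewrite green_identity mulrN oppr_le0.
  rewrite mulr_ge0 ?(ltW (alpha_gt0 _))// sumr_ge0// => x _.
  rewrite sumr_ge0// => y _; rewrite -mulrA mulr_ge0 ?divr_ge0 ?conductance_ge0//.
  by rewrite -expr2 sqr_ge0.
have w0 x : forall c, w c x = 0.
  apply: Minj => d; rewrite -pq.
  have : T d x == 0.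
    move/eqP: T0; rewrite psumr_eq0 => [|e _]; last exact: sumr_ge0.
    move/allP/(_ d (mem_index_enum d)) => /=.
    by rewrite psumr_eq0// => /allP/(_ x (mem_index_enum x)).
  rewrite /T !mulf_eq0 (gt_eqF (mu_gt0 _)) (gt_eqF (h_gt0 _ _)) /=.
  case/orP => /eqP // H; apply/eqP; rewrite subr_eq0; apply/eqP.
  by apply: expR_inj; apply/eqP; rewrite -subr_eq0 H.
by apply/funext => c; apply/funext => x; apply/eqP; rewrite -subr_eq0; apply/eqP/w0.
Qed.

(** The hypothesis on [s] is the recession condition restricted to constant functions: vanishing
    Dirichlet energy makes each component constant, and bounded exponentials mean [M s <= 0]. *)
Lemma exp_system_exists : connected_graph G ->
  (forall s : C -> R, (forall d, \sum_c M d c * s c <= 0) ->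
     0 <= \sum_c s c * \sum_x mu x * k c x -> forall c, s c = 0) ->
  exists u, exp_system u.
Proof.
move=> Gc rec.
pose I := (C * V)%type.
(* Quadratic terms are indexed by a component and an ordered pair of vertices, exponential terms by
   an exponent and a vertex. *)
pose w (e : C * (V * V)) := alpha e.1 * (conductance G e.2.1 e.2.2 / 2).
pose l (e : C * (V * V)) (z : {ptws I -> R}) : R := z (e.1, e.2.1) - z (e.1, e.2.2).
pose cf (j : D * V) := mu j.2 * h j.1 j.2.
pose m (j : D * V) (z : {ptws I -> R}) : R := \sum_c M j.1 c * z (c, j.2).
pose L (z : {ptws I -> R}) : R := \sum_(i : I) mu i.2 * k i.1 i.2 * z (i.1, i.2).
have [z zP] : exists z, forall v,
    \sum_e w e * l e z * l e v + \sum_j cf j * expR (m j z) * m j v = L v.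
  apply: critical_point.
  - by move=> e; rewrite mulr_ge0 ?divr_ge0 ?conductance_ge0// ltW.
  - by move=> j; rewrite mulr_ge0// ltW.
  - by move=> e t u v; rewrite /l; ring.
  - move=> j t u v; rewrite /m mulr_sumr -big_split /=.
    by apply: eq_bigr => c _; ring.
  - move=> t u v; rewrite /L mulr_sumr -big_split /=.
    by apply: eq_bigr => i _; ring.
  - move=> e z; exact: (cvgB (@ptws_proj_continuous R I _ z) (@ptws_proj_continuous R I _ z)).
  - move=> j; apply: (@weighted_sum_continuous R _ C (M j.1) id
      (fun c (z : {ptws I -> R}) => z (c, j.2))) => [x|c]; first exact: cvg_id.
    exact: ptws_proj_continuous.
  - apply: (@weighted_sum_continuous R _ I (fun i => mu i.2 * k i.1 i.2) id
      (fun i (z : {ptws I -> R}) => z (i.1, i.2))) => [x|c]; first exact: cvg_id.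
    exact: ptws_proj_continuous.
  - move=> z Hw Hc HL.
    have zc c x y : z (c, x) = z (c, y).
      apply: (connected_constant (u := fun x => z (c, x))) => // {}x {}y.
      have := Hw (c, (x, y)); rewrite /w /l /= => /eqP.
      rewrite !mulf_eq0 gt_eqF //= invr_eq0 pnatr_eq0 orbF => H.
      by apply/eqP; rewrite mulf_eq0.
    case=> c0 x0; apply: (rec (fun c => z (c, x0))) => [d|].
      have /eqP := Hc (d, x0); rewrite /cf /m /= mulf_eq0 gt_eqF ?mulr_gt0//=.
      by move=> /eqP max0; rewrite -[leRHS]max0 le_max lexx.
    apply: (le_trans HL); rewrite /L.
    rewrite -(pair_bigA _ (fun c x => mu x * k c x * z (c, x))) /=.
    rewrite le_eqVlt; apply/orP; left; apply/eqP; apply: eq_bigr => c _.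
    by rewrite mulr_sumr; apply: eq_bigr => x _; rewrite (zc c x x0) mulrC.
exists (fun c x => z (c, x)) => c0 x0.
(* The residual of the system. The weak equation says that it is orthogonal to every test function;
   the indicator of [(c0, x0)] then isolates one value. *)
pose S (i : I) := - (alpha i.1 * laplacian G mu (fun x => z (i.1, x)) i.2) +
  \sum_d M d i.1 * (h d i.2 * expR (\sum_e M d e * z (e, i.2))) - k i.1 i.2.
have weak v : \sum_(i : I) mu i.2 * S i * v (i.1, i.2) = 0.
  apply/eqP; move/eqP: (zP v); rewrite -subr_eq0; congr (_ == 0).
  have -> : \sum_e w e * l e z * l e v = - \sum_(i : I) mu i.2 *
      (alpha i.1 * laplacian G mu (fun x => z (i.1, x)) i.2) * v (i.1, i.2).
    rewrite -(pair_bigA _ (fun c e => w (c, e) * l (c, e) z * l (c, e) v)) /=.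
    rewrite -(pair_bigA _ (fun c x => mu x *
      (alpha c * laplacian G mu (fun x => z (c, x)) x) * v (c, x))) /=.
    rewrite -sumrN; apply: eq_bigr => c _.
    have -> : \sum_x mu x * (alpha c * laplacian G mu (fun x => z (c, x)) x) * v (c, x)
      = alpha c * \sum_x mu x * laplacian G mu (fun x => z (c, x)) x * v (c, x).
      by rewrite mulr_sumr; apply: eq_bigr => x _; ring.
    rewrite (green_identity (fun x => z (c, x)) (fun x => v (c, x))) mulrN opprK.
    rewrite -(pair_bigA _ (fun x y => w (c, (x, y)) * l (c, (x, y)) z * l (c, (x, y)) v)) /=.
    rewrite mulr_sumr; apply: eq_bigr => x _; rewrite mulr_sumr.
    by apply: eq_bigr => y _; rewrite /w /l /=; ring.
  have -> : \sum_j cf j * expR (m j z) * m j v = \sum_(i : I) mu i.2 *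
      (\sum_d M d i.1 * (h d i.2 * expR (\sum_e M d e * z (e, i.2)))) * v (i.1, i.2).
    rewrite -(pair_bigA _ (fun d x => cf (d, x) * expR (m (d, x) z) * m (d, x) v)) /=.
    rewrite -(pair_bigA _ (fun c x => mu x *
      (\sum_d M d c * (h d x * expR (\sum_e M d e * z (e, x)))) * v (c, x))) /=.
    rewrite exchange_big /= [RHS]exchange_big /=; apply: eq_bigr => x _.
    transitivity (\sum_d \sum_c mu x * (M d c * (h d x *
        expR (\sum_e M d e * z (e, x)))) * v (c, x)).
      apply: eq_bigr => d _; rewrite /m /cf /= mulr_sumr.
      by apply: eq_bigr => c _; ring.
    rewrite exchange_big /=; apply: eq_bigr => c _.
    by rewrite mulr_sumr mulr_suml.
  rewrite /L -sumrN -big_split /= -sumrB; apply: eq_bigr => i _.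
  by rewrite /S; ring.
have := weak (fun i => (i == (c0, x0))%:R).
rewrite (bigD1 (c0, x0)) //= eqxx mulr1 big1 => [|[c x] /negbTE ->]; last by rewrite mulr0.
rewrite addr0 => /eqP; rewrite mulf_eq0 gt_eqF //= /S /= => /eqP; lra.
Qed.

End system.
End graph.

(** * Dirac masses and the scalar equation *)

Lemma integral_dirac_mass (R : realType) (V : finType) (mu : V -> R) (p : V) :
  (forall x, 0 < mu x) -> \sum_x mu x * dirac_mass mu p x = 1.
Proof.
move=> mu_gt0; rewrite (bigD1 p) //= /dirac_mass eqxx divff ?gt_eqF//.
by rewrite big1 ?addr0// => x /negbTE ->; rewrite mulr0.
Qed.

Lemma laplacianN (R : realType) (V : finType) (G : weighted_graph R V)
    (mu u : V -> R) x :
  laplacian G mu (fun y => - u y) x = - laplacian G mu u x.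
Proof.
rewrite /laplacian -mulrN -sumrN; congr (_ * _).
by apply: eq_bigr => y _; ring.
Qed.

(** The system with one component, one exponential and [M = 1]. For a constant [s <= 0], the
    inequality [0 <= s * int k] with [int k > 0] forces [s = 0]. *)
Lemma scalar_exp_equation (R : realType) (V : finType)
    (G : weighted_graph R V) (mu h k : V -> R) :
  connected_graph G -> (forall x, 0 < mu x) -> (forall x, 0 < h x) ->
  0 < \sum_x mu x * k x ->
  exists! u, forall x, laplacian G mu u x = h x * expR (u x) - k x.
Proof.
move=> Gc mu0 h0 k0.
pose M (d c : 'I_1) : R := 1.
have sysP (u : 'I_1 -> V -> R) :
    exp_system G mu (fun=> 1) M (fun=> h) (fun=> k) u <->
    forall x, laplacian G mu (u ord0) x = h x * expR (u ord0 x) - k x.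
  split=> [/(_ ord0) su x|su c x].
    by have := su x; rewrite !big_ord1 !mul1r.
  by rewrite (ord1 c) !big_ord1 !mul1r su.
have Minj s : (forall d : 'I_1, \sum_c M d c * s c = 0) -> forall c, s c = 0.
  by move=> /(_ ord0); rewrite big_ord1 mul1r => s0 c; rewrite ord1.
have [//|||u /sysP su] := @exp_system_exists _ _ G mu mu0 _ _
    (fun=> 1) M (fun=> h) (fun=> k) _ _ Gc.
- by [].
- move=> s /(_ ord0); rewrite !big_ord1 mul1r => s0.
  rewrite pmulr_lge0// => s1 c; rewrite ord1; apply/eqP.
  by rewrite eq_le s0 s1.
exists (u ord0); split=> // v sv.
have /(congr1 (@^~ ord0)) := @exp_system_unique _ _ G mu mu0 _ _ (fun=> 1) M
  (fun=> h) (fun=> k) (fun=> ltr01) (fun=> h0) u (fun=> v) Minj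
  ((sysP u).2 su) ((sysP (fun=> v)).2 sv).
by [].
Qed.

(** * The Chern-Simons system *)

Section chern_simons.
Variables (R : realType) (V : finType) (G : weighted_graph R V) (mu : V -> R).
Variables (r m_e m_g : R) (g : V -> R).
Hypotheses (Gc : connected_graph G) (mu_gt0 : forall x, 0 < mu x).
Hypotheses (me0 : m_e <> 0) (mg0 : m_g <> 0).

(** Here [r] stands for the integer [N] and [g] for the source [4 pi] times the sum of Dirac
    masses. *)
Definition cs_system (u1 u2 : V -> R) := forall x,
  laplacian G mu u1 x = - (r * m_e ^+ 2)
    + m_e ^+ 2 * (expR (u1 x / r + (r - 1) / r * u2 x)
                  + (r - 1) * expR (u1 x / r - u2 x / r)) + g x /\
  laplacian G mu u2 x =
    m_g ^+ 2 * (expR (u1 x / r + (r - 1) / r * u2 x)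
                - expR (u1 x / r - u2 x / r)) + g x.

Let me2 : 0 < m_e ^+ 2. Proof. by rewrite exprn_even_gt0 //=; apply/eqP. Qed.
Let mg2 : 0 < m_g ^+ 2. Proof. by rewrite exprn_even_gt0 //=; apply/eqP. Qed.

Let me2_neq0 : m_e ^+ 2 != 0. Proof. by rewrite gt_eqF. Qed.
Let mg2_neq0 : m_g ^+ 2 != 0. Proof. by rewrite gt_eqF. Qed.
Let me_neq0 : m_e != 0. Proof. exact/eqP. Qed.
Let mg_neq0 : m_g != 0. Proof. exact/eqP. Qed.

(** Integrating removes the Laplacians and leaves two linear relations between [A = int exp a] and
    [B = int exp b]. Eliminating [B] shows that [A], positive since [x0] makes [V] nonempty, is the
    gap in the inequality. *)
Lemma cs_system_necessary u1 u2 (x0 : V) : 0 < r ->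
  cs_system u1 u2 ->
  (\sum_x mu x * g x) / (r * m_e ^+ 2) +
    (\sum_x mu x * g x) * (r - 1) / (r * m_g ^+ 2) < volume mu.
Proof.
move=> r0 s.
pose a x := expR (u1 x / r + (r - 1) / r * u2 x).
pose b x := expR (u1 x / r - u2 x / r).
have r_neq0 : r != 0 by rewrite gt_eqF.
have rme_neq0 : r * m_e ^+ 2 != 0 by rewrite mulf_neq0.
have A0 : 0 < \sum_x mu x * a x.
  rewrite (bigD1 x0) //= ltr_pwDl ?mulr_gt0 ?expR_gt0 ?sumr_ge0// => x _.
  by rewrite mulr_ge0 ?expR_ge0// ltW.
have E1 : 0 = - (r * m_e ^+ 2) * volume mu + m_e ^+ 2 * (\sum_x mu x * a x) +
    m_e ^+ 2 * (r - 1) * (\sum_x mu x * b x) + \sum_x mu x * g x.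
  rewrite -[LHS](integral_laplacian G mu_gt0 u1) /volume !mulr_sumr -!big_split /=.
  by apply: eq_bigr => x _; rewrite (s x).1 /a /b; ring.
have E2 : 0 = m_g ^+ 2 * (\sum_x mu x * a x) - m_g ^+ 2 * (\sum_x mu x * b x)
    + \sum_x mu x * g x.
  rewrite -[LHS](integral_laplacian G mu_gt0 u2) !mulr_sumr -sumrB -!big_split /=.
  by apply: eq_bigr => x _; rewrite (s x).2 /a /b; ring.
move: A0 E1 E2; move: (\sum_x mu x * a x) (\sum_x mu x * b x) => A B A0 E1 E2.
have -> : volume mu = A + (\sum_x mu x * g x) / (r * m_e ^+ 2) +
    (\sum_x mu x * g x) * (r - 1) / (r * m_g ^+ 2).
  have -> : volume mu = (m_e ^+ 2 * A + m_e ^+ 2 * (r - 1) * B +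
      \sum_x mu x * g x) / (r * m_e ^+ 2).
    apply: (mulIf (x := r * m_e ^+ 2)) => //; rewrite divfK//; lra.
  have -> : B = A + (\sum_x mu x * g x) / m_g ^+ 2.
    by apply: (mulfI (x := m_g ^+ 2)) => //; rewrite mulrDr mulrCA divff//; lra.
  by field; apply/and3P.
by rewrite -[ltRHS]addrA ltrDr.
Qed.

Lemma cs_system_solvable_gt1 : 1 < r -> (forall x, 0 <= g x) ->
  (\sum_x mu x * g x) / (r * m_e ^+ 2) +
    (\sum_x mu x * g x) * (r - 1) / (r * m_g ^+ 2) < volume mu ->
  exists! u : (V -> R) * (V -> R), cs_system u.1 u.2.
Proof.
move=> r1 g0 vol.
have r0 : 0 < r by lra.
have q0 : 0 < r - 1 by lra.
have r_neq0 : r != 0 by rewrite gt_eqF.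
(* The index [true] stands for [u1] and the exponent [a], [false] for [u2] and [b]. Dividing the
   first equation by [m_e^2] and multiplying the second by [(r - 1) / m_g^2] gives the transpose
   structure; positivity of [alpha false] and [h false] uses [r > 1]. *)
pose alpha (c : bool) := if c then (m_e ^+ 2)^-1 else (r - 1) / m_g ^+ 2.
pose M (d c : bool) := if c then r^-1 else if d then (r - 1) / r else - r^-1.
pose h (d : bool) (x : V) := if d then r else r * (r - 1).
pose k (c : bool) x := if c then r - g x / m_e ^+ 2
                       else - ((r - 1) * g x / m_g ^+ 2).
have alpha0 c : 0 < alpha c by case: c; rewrite /alpha ?invr_gt0 ?divr_gt0.
have h0 d x : 0 < h d x by case: d; rewrite /h ?mulr_gt0.
have argT (u : bool -> V -> R) x : \sum_e M true e * u e x =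
    u true x / r + (r - 1) / r * u false x.
  by rewrite big_bool /M /= mulrC.
have argF (u : bool -> V -> R) x : \sum_e M false e * u e x =
    u true x / r - u false x / r.
  by rewrite big_bool /M /= mulrC mulNr [r^-1 * _]mulrC.
have sysP u : exp_system G mu alpha M h k u <-> cs_system (u true) (u false).
  split=> [s x|s [] x]; last first.
  - rewrite (s x).2 big_bool argT argF /alpha /M /h /k /=.
    by field; do ?[apply/andP; split].
  - rewrite (s x).1 big_bool argT argF /alpha /M /h /k /=.
    by field; do ?[apply/andP; split].
  split.
    apply: (mulfI (x := alpha true)); first by rewrite gt_eqF.
    rewrite (s true x) big_bool argT argF /alpha /M /h /k /=.
    by field; do ?[apply/andP; split].
  apply: (mulfI (x := alpha false)); first by rewrite gt_eqF.
  rewrite (s false x) big_bool argT argF /alpha /M /h /k /=.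
  by field; do ?[apply/andP; split].
(* The explicit inverse of [M]; it yields injectivity and the coordinates [(a, b)] for the recession
   condition. *)
have Msolve (s : bool -> R) a b : \sum_c M true c * s c = a ->
    \sum_c M false c * s c = b -> s true = a + (r - 1) * b /\ s false = a - b.
  by rewrite !big_bool /M /= => <- <-; split; field.
have Minj s : (forall d, \sum_c M d c * s c = 0) -> forall c, s c = 0.
  move=> s0; have [st sf] := Msolve s 0 0 (s0 true) (s0 false).
  by case; rewrite ?st ?sf; ring.
have [|u su] := @exp_system_exists _ _ G mu mu_gt0 _ _ alpha M h k alpha0 h0 Gc.
  move=> s s_le0.
  have [st sf] := Msolve s _ _ erefl erefl.
  move: st sf (s_le0 true) (s_le0 false).
  move: (\sum_c M true c * s c) (\sum_c M false c * s c) => a b st sf a0 b0.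
  pose q := \sum_x mu x * g x.
  have kT : \sum_x mu x * k true x = r * volume mu - q / m_e ^+ 2.
    rewrite /q /volume mulr_sumr mulr_suml -sumrB.
    by apply: eq_bigr => x _; rewrite /k; ring.
  have kF : \sum_x mu x * k false x = - ((r - 1) * q / m_g ^+ 2).
    rewrite /q mulr_sumr mulr_suml -sumrN.
    by apply: eq_bigr => x _; rewrite /k; ring.
  have q_ge0 : 0 <= q by rewrite sumr_ge0// => x _; rewrite mulr_ge0// ltW.
  (* The coefficient of [a] in the linear form on constants: [r] times the gap in the volume
     condition. *)
  have X0 : 0 < r * volume mu - q / m_e ^+ 2 - (r - 1) * q / m_g ^+ 2.
    move: vol; rewrite -/q -(ltr_pM2l r0) -subr_gt0; congr (0 < _).
    by field; do ?[apply/andP; split].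
  have qg : 0 <= q / m_g ^+ 2 by rewrite divr_ge0// ltW.
  (* The coefficient of [b]: the last factor is the previous coefficient plus [r * q / m_g^2]. As
     [a, b <= 0], a nonnegative value of the form forces [a = b = 0]. *)
  have Y0 : 0 < (r - 1) * (r * volume mu - q / m_e ^+ 2 + q / m_g ^+ 2).
    rewrite mulr_gt0//; nra.
  rewrite big_bool /= kT kF st sf => H.
  have {}H : 0 <= a * (r * volume mu - q / m_e ^+ 2 - (r - 1) * q / m_g ^+ 2) +
      b * ((r - 1) * (r * volume mu - q / m_e ^+ 2 + q / m_g ^+ 2)).
    by move: H; congr (0 <= _); ring.
  have aX := mulr_le0_ge0 a0 (ltW X0); have bY := mulr_le0_ge0 b0 (ltW Y0).
  have /eqP : a * (r * volume mu - q / m_e ^+ 2 - (r - 1) * q / m_g ^+ 2) = 0 by lra.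
  rewrite mulf_eq0 (gt_eqF X0) orbF => /eqP aE.
  have /eqP : b * ((r - 1) * (r * volume mu - q / m_e ^+ 2 + q / m_g ^+ 2)) = 0 by lra.
  rewrite mulf_eq0 (gt_eqF Y0) orbF => /eqP bE.
  by case; rewrite ?st ?sf aE bE; ring.
exists (u true, u false); split=> [|[v1 v2] /= sv]; first exact/sysP.
have uv := exp_system_unique mu_gt0 alpha0 h0 Minj su
  ((sysP (fun c : bool => if c then v1 else v2)).2 sv).
by rewrite uv.
Qed.

(** At [r = 1] the first equation involves [u1] alone, and the volume condition is its solvability
    condition. Given [u1], the second is a scalar equation for [- u2] whose source
    [m_g^2 exp u1 + g] has positive integral. *)
Lemma cs_system_solvable1 (x0 : V) : r = 1 -> (forall x, 0 <= g x) ->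
  (\sum_x mu x * g x) / m_e ^+ 2 < volume mu ->
  exists! u : (V -> R) * (V -> R), cs_system u.1 u.2.
Proof.
move=> r1 g0 vol.
have sysP u1 u2 : cs_system u1 u2 <->
    (forall x, laplacian G mu u1 x = m_e ^+ 2 * expR (u1 x) - (m_e ^+ 2 - g x)) /\
    (forall x, laplacian G mu (fun y => - u2 y) x =
      m_g ^+ 2 * expR (u1 x) * expR (- u2 x) - (m_g ^+ 2 * expR (u1 x) + g x)).
  have E x : expR (u1 x / 1 - u2 x / 1) = expR (u1 x) * expR (- u2 x).
    by rewrite !divr1 expRD.
  rewrite /cs_system r1 subrr mul0r; split=> [s|[s1 s2] x].
    split=> x; have [s1 s2] := s x.
      by rewrite s1 mul0r !mul0r !addr0 divr1; ring.
    by rewrite laplacianN s2 E !mul0r !addr0 divr1; ring.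
  rewrite E s1 mul0r !mul0r !addr0 divr1; split; first by ring.
  by have := s2 x; rewrite laplacianN => /eqP; rewrite eqr_oppLR => /eqP ->; ring.
have [||u1 [s1 uniq1]] := @scalar_exp_equation _ _ G mu (fun=> m_e ^+ 2)
    (fun x => m_e ^+ 2 - g x) Gc mu_gt0.
- by [].
- under eq_bigr do rewrite mulrBr.
  by rewrite sumrB -mulr_suml subr_gt0 -ltr_pdivrMr.
have [||w [s2 uniq2]] := @scalar_exp_equation _ _ G mu
    (fun x => m_g ^+ 2 * expR (u1 x)) (fun x => m_g ^+ 2 * expR (u1 x) + g x)
    Gc mu_gt0.
- by move=> x; rewrite mulr_gt0 ?expR_gt0.
- rewrite (bigD1 x0) //= ltr_pwDl//.
    by rewrite mulr_gt0// ltr_pwDl// mulr_gt0 ?expR_gt0.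
  apply: sumr_ge0 => x _; apply: mulr_ge0; first exact: ltW.
  by apply: addr_ge0 => //; rewrite mulr_ge0 ?expR_ge0// ltW.
have NN (f : V -> R) : (fun y => - - f y) = f.
  by apply/funext => y; rewrite opprK.
exists (u1, fun y => - w y); split=> [|[v1 v2] /= /sysP [t1 t2]].
  by apply/sysP; split=> //= x; rewrite NN opprK.
have E1 := uniq1 _ t1; subst v1.
by rewrite (uniq2 _ t2) NN.
Qed.

End chern_simons.

(** * The equivalence for Dirac sources *)

Theorem theorem1p1 (R : realType) (V : finType) (G : weighted_graph R V)
    (Gconn : connected_graph G)
    (mu : V -> R) (mu_gt0 : forall x : V, 0 < mu x)
    (n N : nat) (n_gt0 : (0 < n)%N) (N_gt0 : (0 < N)%N)
    (m_e m_g : R) (m_e_neq0 : m_e <> 0) (m_g_neq0 : m_g <> 0)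
    (p : 'I_n -> V) :
  (exists! u : (V -> R) * (V -> R),
    let u1 := u.1 in
    let u2 := u.2 in
    forall x : V,
      laplacian G mu u1 x =
        - (N%:R * m_e ^+ 2)
        + m_e ^+ 2 * (expR (u1 x / N%:R + (N%:R - 1) / N%:R * u2 x)
                      + (N%:R - 1) * expR (u1 x / N%:R - u2 x / N%:R))
        + 4 * pi * \sum_(j < n) dirac_mass mu (p j) x
      /\
      laplacian G mu u2 x =
        m_g ^+ 2 * (expR (u1 x / N%:R + (N%:R - 1) / N%:R * u2 x)
                    - expR (u1 x / N%:R - u2 x / N%:R))
        + 4 * pi * \sum_(j < n) dirac_mass mu (p j) x)
  <->
  volume mu > 4 * pi * n%:R / (N%:R * m_e ^+ 2)
              + 4 * pi * n%:R * (N%:R - 1) / (N%:R * m_g ^+ 2).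
Proof.
(* As [n] is positive, [p] supplies a vertex. *)
have x0 : V := p (Ordinal n_gt0).
have r0 : 0 < N%:R :> R by rewrite ltr0n.
pose g x : R := 4 * pi * \sum_(j < n) dirac_mass mu (p j) x.
have g0 x : 0 <= g x.
  rewrite !mulr_ge0 ?pi_ge0 ?sumr_ge0// => j _.
  by rewrite /dirac_mass; case: ifP => // _; rewrite invr_ge0 ltW.
(* Each Dirac mass has integral one, so the volume condition can be rewritten with the integral of
   [g]. *)
have gE : \sum_x mu x * g x = 4 * pi * n%:R.
  under eq_bigr do rewrite mulrCA mulr_sumr.
  rewrite -mulr_sumr exchange_big /=; congr (_ * _).
  under eq_bigr do rewrite integral_dirac_mass//.
  by rewrite sumr_const card_ord.
rewrite -gE; split.
  by case=> -[u1 u2] [/= s _]; exact: (@cs_system_necessary R V G mu _ _ _ g _ _ _ u1 u2 x0).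
case: (ltngtP N 1) => [||N1]; first by rewrite ltnNge N_gt0.
  move=> N1; apply: cs_system_solvable_gt1 => //.
  by rewrite ltr1n.
move=> vol; apply: cs_system_solvable1 => //; first by rewrite N1.
by move: vol; rewrite N1 subrr mulr0 mul0r addr0 mul1r.
Qed.
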